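(* A $\Box$-free formula $\varphi$ is satisfiable (falsifiable) over the class of dynamic posets if and only if it is satisfiable (falsifiable) over the class of dynamical systems.
   Context: Formulas are built from propositional variables and $\bot$ by $\wedge,\vee,\to,\circ,\Diamond$ (no $\Box$). A dynamical system is $(X,\mathcal T,S)$ with $(X,\mathcal T)$ a topological space and $S\colon X\to X$ continuous; a dynamic poset is one whose topology is the up-set topology of a partial order $\preccurlyeq$ (open = upward closed), with $S$ monotone. A valuation maps formulas to open sets with $[\![\bot]\!]=\varnothing$, $[\![\varphi\wedge\psi]\!]=[\![\varphi]\!]\cap[\![\psi]\!]$, $[\![\varphi\vee\psi]\!]=[\![\varphi]\!]\cup[\![\psi]\!]$, $[\![\varphi\to\psi]\!]=((X\setminus[\![\varphi]\!])\cup[\![\psi]\!])^\circ$ (interior), $[\![\circ\varphi]\!]=S^{-1}[\![\varphi]\!]$, $[\![\Diamond\varphi]\!]=\bigcup_{n\ge0}S^{-n}[\![\varphi]\!]$. A formula is satisfiable (falsifiable) over a class if for some system in the class, some valuation, and some point $x$, we have $x\in[\![\varphi]\!]$ (respectively $x\notin[\![\varphi]\!]$). *)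

(* Defs.v *)
From HB Require Import structures.
From mathcomp Require Import all_boot all_order.
From mathcomp Require Import boolp classical_sets functions topology.

Set Implicit Arguments.
Unset Strict Implicit.
Unset Printing Implicit Defensive.

Local Open Scope classical_set_scope.

(* The language has no box constructor, so every [formula] is box-free. *)
Inductive formula : Type :=
  | Var of nat
  | Bot
  | And of formula & formula
  | Or of formula & formula
  | Imp of formula & formula
  | Next of formula
  | Dia of formula.

Record dynamical_system := DynamicalSystem {
  space :> topologicalType;
  step : space -> space;
  step_continuous : continuous step }.

(* The conditions relating the values of V on compound formulas to those on
   their parts; V is unconstrained on variables, up to openness. *)
Record valuation (D : dynamical_system) (V : formula -> set D) : Prop := {
  val_open : forall phi, open (V phi);
  val_bot : V Bot = set0;
  val_and : forall phi psi, V (And phi psi) = V phi `&` V psi;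
  val_or : forall phi psi, V (Or phi psi) = V phi `|` V psi;
  val_imp : forall phi psi, V (Imp phi psi) = (~` V phi `|` V psi)°;
  val_next : forall phi, V (Next phi) = @step D @^-1` V phi;
  val_dia : forall phi, V (Dia phi) = \bigcup_n iter n (@step D) @^-1` V phi }.

Definition upward_closed (T : Type) (le : rel T) (U : set T) : Prop :=
  forall x y, le x y -> U x -> U y.

(* Classes of systems are plain predicates: [set dynamical_system] would be a
   universe inconsistency. *)
Definition dynamic_posets (D : dynamical_system) : Prop :=
  exists le : rel D,
    [/\ reflexive le, antisymmetric le, transitive le,
        forall U : set D, open U <-> upward_closed le U
      & {homo @step D : x y / le x y}].

Definition dynamical_systems (D : dynamical_system) : Prop := True.

Definition satisfiable_over (K : dynamical_system -> Prop) (phi : formula) : Prop :=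
  exists (D : dynamical_system) (V : formula -> set D) (x : D),
    [/\ K D, valuation V & V phi x].

Definition falsifiable_over (K : dynamical_system -> Prop) (phi : formula) : Prop :=
  exists (D : dynamical_system) (V : formula -> set D) (x : D),
    [/\ K D, valuation V & ~ V phi x].

(* Main.v *)
(** Given a valuation V on a dynamical system (X,S), the points of the poset are
    the finite sets F of pairs (i, psi), read "psi holds at time i", that some x
    in X realizes: psi holds at S^i x for each pair, and F contains enough other
    pairs to witness this (for [Imp a b] at time i, the pair (i, b) is demanded
    only when a holds at S^i x). The order is inclusion and the step map decreases
    times by one, discarding time 0. A pair (0, psi) in F forces psi at F, while psi
    at F forces V psi at every x realizing F. For the second half, if x refutes
    [Imp a b] then, F being finite, its pairs hold in a neighbourhood of x; this
    contains some y where a holds and b fails, and F with (0, a) added can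
    be completed to a finite set realized by y. *)
From HB Require Import structures.
From mathcomp Require Import all_boot all_order.
From mathcomp Require Import boolp classical_sets functions cardinality topology.
Require Import Defs.

Set Implicit Arguments.
Unset Strict Implicit.
Unset Printing Implicit Defensive.

Local Open Scope classical_set_scope.

Lemma nbhs_finite_bigcap (T : topologicalType) (I : Type) (D : set I)
    (P : I -> set T) (x : T) :
  finite_set D -> (forall i, D i -> nbhs x (P i)) ->
  nbhs x (\bigcap_(i in D) P i).
Proof.
(* [filter_bigI] intersects over finite sets in a choice type; [Pchoice] equips the arbitrary index
   type with that structure. *)
elim/Pchoice: I => I in D P *.
by move=> /finite_fsetP[A ->] nbhsP; apply: filter_bigI.
Qed.

(** * Valuations generated by open sets for the variables *)

Section CanonicalValuation.
Variables (D : dynamical_system) (v : nat -> set D).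

Fixpoint eval (phi : formula) : set D :=
  match phi with
  | Var n => v n
  | Bot => set0
  | And a b => eval a `&` eval b
  | Or a b => eval a `|` eval b
  | Imp a b => (~` eval a `|` eval b)°
  | Next a => @step D @^-1` eval a
  | Dia a => \bigcup_n iter n (@step D) @^-1` eval a
  end.

Lemma continuous_iter_step n : continuous (iter n (@step D)).
Proof.
elim: n => [|n IHn] x; first exact: cvg_id.
by apply: continuous_comp; [exact: IHn|exact: step_continuous].
Qed.

Lemma valuation_eval : (forall n, open (v n)) -> valuation eval.
Proof.
move=> vo; split=> //.
elim=> [n||a IHa b IHb|a IHa b IHb|a _ b _|a IHa|a IHa] /=.
- exact: vo.
- exact: open0.
- exact: openI.
- exact: openU.
- exact: open_interior.
- by apply: open_comp => // x _; exact: step_continuous.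
- apply: bigcup_open => n _.
  by apply: open_comp => // x _; exact: continuous_iter_step.
Qed.

End CanonicalValuation.

(** * Finite sets of timed formulas and their realization *)

Definition obligations := set (nat * formula).

Definition shift (F : obligations) : obligations :=
  (fun a : nat * formula => (a.1.+1, a.2)) @^-1` F.

Lemma finite_shift F : finite_set F -> finite_set (shift F).
Proof.
move=> finF; apply: finite_preimage => //.
by move=> [i a] [j b] _ _ [-> ->].
Qed.

Section Realization.
Variables (D : dynamical_system) (V : formula -> set D).
Hypothesis valV : valuation V.

Definition holds (x : D) (a : nat * formula) : Prop :=
  V a.2 (iter a.1 (@step D) x).

(** The [Imp] clause tests truth of [a] at [x] rather than membership of [(i, a)] in [F]. Every
    clause is thus monotone in [F], so the sets realized by one [x] are closed under finite
    unions. *)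
Definition witnessed (x : D) (F : obligations) (a : nat * formula) : Prop :=
  let: (i, psi) := a in
  match psi with
  | Var _ => True
  | Bot => False
  | And a b => F (i, a) /\ F (i, b)
  | Or a b => F (i, a) \/ F (i, b)
  | Imp a b => holds x (i, a) -> F (i, b)
  | Next a => F (i.+1, a)
  | Dia a => exists n, F (n + i, a)
  end.

Definition realizes (x : D) (F : obligations) : Prop :=
  [/\ finite_set F, F `<=` holds x & F `<=` witnessed x F].

Lemma witnessed_mono x F G a : F `<=` G -> witnessed x F a -> witnessed x G a.
Proof.
move=> FG; case: a => i [n||a b|a b|a b|a|a] //=.
- by move=> [/FG ? /FG ?].
- by move=> [/FG|/FG]; [left|right].
- by move=> Fb /Fb /FG.
- exact: FG.
- by move=> [n /FG]; exists n.
Qed.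

Lemma realizes_bigcup x (I : Type) (A : set I) (F : I -> obligations) :
  finite_set A -> (forall i, A i -> realizes x (F i)) ->
  realizes x (\bigcup_(i in A) F i).
Proof.
move=> finA rF; split.
- by apply: bigcup_finite => // i /rF[].
- by move=> a [i /rF[_ + _]] => /[apply].
- move=> a [i Ai Fa]; have [_ _ /(_ _ Fa)] := rF i Ai.
  by apply: witnessed_mono => b Fb; exists i.
Qed.

Lemma realizes_setU x F G : realizes x F -> realizes x G -> realizes x (F `|` G).
Proof.
move=> [finF Fx wF] [finG Gx wG]; split; first by rewrite finite_setU.
- by move=> a [/Fx|/Gx].
- by move=> a [/wF|/wG]; apply: witnessed_mono => b ?; [left|right].
Qed.

Lemma realizes_setU1 x a F :
  realizes x F -> holds x a -> witnessed x F a -> realizes x (a |` F).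
Proof.
move=> [finF Fx wF] xa wa; split.
- by rewrite finite_setU; split; first exact: finite_set1.
- by move=> b [->|/Fx].
- by move=> b [->|/wF]; [move: wa|]; apply: witnessed_mono => c ?; right.
Qed.

Lemma realizes_set0 x : realizes x set0.
Proof. by split. Qed.

Lemma realizes_shift x F : realizes x F -> realizes (@step D x) (shift F).
Proof.
move=> [finF Fx wF]; split; first exact: finite_shift.
- by move=> [i psi] /Fx; rewrite /holds /= -iterSr.
- move=> [i psi] /[dup] /Fx xF /wF.
  case: psi xF => [n||a b|a b|a b|a|a] //= xF; first by rewrite /holds /= -iterSr.
  by move=> [n]; exists n; rewrite /shift /= -addnS.
Qed.

(** Induction on the formula: finitely many pairs with immediate subformulas witness each
    connective. A single time suffices for [Dia], which keeps the set finite. *)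
Lemma realizer_exists x a : holds x a -> exists2 F, realizes x F & F a.
Proof.
case: a => i psi.
have add_witnessed j c : (exists2 F, realizes x F & witnessed x F (j, c)) ->
    holds x (j, c) -> exists2 F, realizes x F & F (j, c).
  move=> [F rF wF] xc.
  by exists ((j, c) |` F); [exact: realizes_setU1|left].
elim: psi i => [n||a IHa b IHb|a IHa b IHb|a IHa b IHb|a IHa|a IHa] i xi;
  apply: add_witnessed (xi); move: xi; rewrite /holds /=.
- by exists set0; first exact: realizes_set0.
- by rewrite (val_bot valV).
- rewrite (val_and valV) => -[/(IHa i)[F rF Fa] /(IHb i)[G rG Gb]].
  by exists (F `|` G); [exact: realizes_setU|split; [left|right]].
- by rewrite (val_or valV) => -[/(IHa i)[F rF Fa]|/(IHb i)[F rF Fb]];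
    exists F => //; [left|right].
- rewrite (val_imp valV) => /interior_subset[nxa|/(IHb i)[F rF Fb]].
    by exists set0; [exact: realizes_set0|move=> /nxa].
  by exists F.
- by rewrite (val_next valV) => /(IHa i.+1).
- rewrite (val_dia valV) => -[n _]; rewrite /= -iterD => /(IHa (n + i))[F rF Fa].
  by exists F => //; exists n.
Qed.

Lemma realizer_extends x F :
  finite_set F -> F `<=` holds x -> exists2 G, realizes x G & F `<=` G.
Proof.
move=> finF Fx.
(* [choice] needs a total relation, so pairs outside [F] get the dummy value [set0]. *)
have /choice[G GP] a : exists G, F a -> realizes x G /\ G a.
  have [/Fx xa|nFa] := pselect (F a); last by exists set0.
  by have [G rG Ga] := realizer_exists xa; exists G.
exists (\bigcup_(a in F) G a); last by move=> a Fa; exists a => //; apply GP.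
by apply: realizes_bigcup => // a /GP[].
Qed.

(** Each pair holds on an open set, the preimage of an open set under an iterate of the step. Being
    witnessed need not persist nearby; [realizer_extends] restores it. *)
Lemma nbhs_holds x F :
  finite_set F -> F `<=` holds x -> \forall y \near x, F `<=` holds y.
Proof.
move=> finF Fx.
suff : nbhs x (\bigcap_(a in F) [set y | holds y a]) by [].
apply: nbhs_finite_bigcap => // a /Fx xa.
apply: open_nbhs_nbhs; split=> //.
apply: (@open_comp _ _ (iter a.1 (@step D)) (V a.2)); last exact: val_open.
by move=> y _; exact: continuous_iter_step.
Qed.

(** * The dynamic poset of realizable sets *)

Definition point := {F : obligations | exists x, realizes x F}.

HB.instance Definition _ := gen_eqMixin point.
HB.instance Definition _ := gen_choiceMixin point.

Definition point_le : rel point := fun F G => `[< sval F `<=` sval G >].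

Lemma up_openT : upward_closed point_le setT.
Proof. by []. Qed.

Lemma up_openI : setI_closed (upward_closed point_le).
Proof. by move=> A B upA upB F G FG [/(upA _ _ FG) ? /(upB _ _ FG)]. Qed.

Lemma up_open_bigU (I : Type) (f : I -> set point) :
  (forall i, upward_closed point_le (f i)) ->
  upward_closed point_le (\bigcup_i f i).
Proof. by move=> upf F G FG [i _ /(upf i _ _ FG)]; exists i. Qed.

HB.instance Definition _ :=
  isOpenTopological.Build point up_openT up_openI up_open_bigU.

Lemma open_pointE (U : set point) : open U <-> upward_closed point_le U.
Proof. by []. Qed.

Lemma interior_pointP (U : set point) (F : point) :
  (U°) F <-> forall G, point_le F G -> U G.
Proof.
split=> [UF G FG|UF].
  by apply: interior_subset; apply: (open_interior U) FG UF.
(* The cone above [F] is its least open neighbourhood. *)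
rewrite /interior nbhsE; exists (point_le F) => //; split; last exact/asboolP.
by move=> G H /asboolP GH /asboolP FG; apply/asboolP; exact: subset_trans GH.
Qed.

Lemma realizable_shift (F : point) : exists x, realizes x (shift (sval F)).
Proof. by have [x rF] := svalP F; exists (@step D x); exact: realizes_shift. Qed.

Definition point_step (F : point) : point := exist _ _ (realizable_shift F).

Lemma point_step_homo : {homo point_step : F G / point_le F G}.
Proof. by move=> F G /asboolP FG; apply/asboolP => a /FG. Qed.

Lemma point_step_continuous : continuous point_step.
Proof.
apply/continuousP => A /open_pointE upA; apply/open_pointE => F G FG.
by apply: upA; exact: point_step_homo.
Qed.

Definition point_system := DynamicalSystem point_step_continuous.

Lemma point_system_poset : dynamic_posets point_system.
Proof.
exists point_le; split=> //.
- by move=> F; exact/asboolP.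
- move=> [F rF] [G rG] /andP[/asboolP FG /asboolP GF].
  by apply: eq_exist; apply/seteqP; split.
- by move=> F G H /asboolP FG /asboolP /(subset_trans FG) ?; exact/asboolP.
- exact: point_step_homo.
Qed.

(** * Truth in the poset *)

Definition point_var (n : nat) : set point_system := [set F | sval F (0, Var n)].

Lemma valuation_point : valuation (eval point_var).
Proof.
apply: valuation_eval => n; apply/open_pointE => F G /asboolP FG.
exact: FG.
Qed.

Lemma sval_iter_step n (F : point_system) a :
  sval (iter n (@step point_system) F) a = sval F (n + a.1, a.2).
Proof.
elim: n a => [|n IHn] [i psi] //=.
by rewrite [LHS]IHn /= addnS addSn.
Qed.

Lemma realizes_iter_step n x (F : point_system) : realizes x (sval F) ->
  realizes (iter n (@step D) x) (sval (iter n (@step point_system) F)).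
Proof. by elim: n => //= n IHn /IHn; exact: realizes_shift. Qed.

(** Both halves go through one induction because [Imp] exchanges them at its antecedent: each half
    for [Imp a b] uses the opposite half for [a] and the same half for [b]. *)
Lemma eval_point psi (F : point_system) :
  (sval F (0, psi) -> eval point_var psi F) /\
  (eval point_var psi F -> forall x, realizes x (sval F) -> V psi x).
Proof.
elim: psi F => [n||a IHa b IHb|a IHa b IHb|a IHa b IHb|a IHa|a IHa] F /=.
- by split=> // Fn x [_ Fx _]; exact: Fx Fn.
- by split=> //; have [x [_ _ wF]] := svalP F; exact: wF.
- split=> [Fab|[/(IHa F).2 Va /(IHb F).2 Vb] x rF].
    have [x [_ _ /(_ _ Fab)[Fa Fb]]] := svalP F.
    by split; [exact: (IHa F).1|exact: (IHb F).1].
  by rewrite (val_and valV); split; [exact: Va|exact: Vb].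
- split=> [Fab|Vab x rF].
    have [x [_ _ /(_ _ Fab)[Fa|Fb]]] := svalP F.
      by left; exact: (IHa F).1.
    by right; exact: (IHb F).1.
  rewrite (val_or valV).
  by case: Vab => [/(IHa F).2|/(IHb F).2] VF; [left|right]; exact: VF.
- split=> [Fab|Fab x rF].
    apply/interior_pointP => G /asboolP /(_ _ Fab) Gab.
    have [aG|] := pselect (eval point_var a G); last by left.
    (* Since [a] is true at [G], it holds at the realizer [y], so [Gab] demands [(0, b)] in [G]. *)
    right; apply: (IHb G).1; have [y rG] := svalP G.
    have [_ _ /(_ _ Gab)] := rG; apply.
    exact: (IHa G).2.
  apply: contrapT => nxab; have [finF Fx _] := rF.
  have [y [Fy ya nyb]] : exists y, [/\ sval F `<=` holds y, V a y & ~ V b y].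
    apply: contrapT => H; apply: nxab; rewrite (val_imp valV).
    apply: filterS (nbhs_holds finF Fx) => y Fy.
    have [ya|] := pselect (V a y); last by left.
    by right; apply: contrapT => nyb; apply: H; exists y.
  have [ | | G rG FG] := @realizer_extends y ((0, a) |` sval F).
  + by rewrite finite_setU; split; first exact: finite_set1.
  + by move=> c [->|/Fy].
  have rG' : exists y, realizes y G by exists y.
  pose G' : point_system := exist _ G rG'.
  have FG' : point_le F G' by apply/asboolP => c Fc; apply: FG; right.
  (* [G'] contains [(0, a)], so [a] is true there; then [b] is too, and hence holds at [y], a
     contradiction. *)
  have [na|bG] := (interior_pointP _ _).1 Fab G' FG'.
    by apply: na; apply: (IHa G').1; apply: FG; left.
  by apply: nyb; exact: (IHb G').2 bG _ rG.
- split=> [Fa|/(IHa _).2 Va x rF].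
    have [x [_ _ /(_ _ Fa) Fa1]] := svalP F.
    exact: (IHa (point_step F)).1.
  by rewrite (val_next valV); apply: Va; exact: realizes_shift.
- split=> [Fa|[n _ /(IHa _).2 Va] x rF].
    have [x [_ _ /(_ _ Fa)[n Fna]]] := svalP F.
    (* The witness pair has time [n + 0], exactly what time 0 becomes after undoing [n] shifts. *)
    by exists n => //; apply: (IHa _).1; rewrite sval_iter_step.
  by rewrite (val_dia valV); exists n => //; apply: Va; exact: realizes_iter_step.
Qed.

End Realization.

Theorem theorem8p1 (phi : formula) :
  (satisfiable_over dynamic_posets phi <-> satisfiable_over dynamical_systems phi) /\
  (falsifiable_over dynamic_posets phi <-> falsifiable_over dynamical_systems phi).
Proof.
split; split.
- by move=> [D [V [x [_ valV Vx]]]]; exists D, V, x.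
- move=> [D [V [x [_ valV Vx]]]].
  have [F rF Fphi] := @realizer_exists D V valV x (0, phi) Vx.
  exists (point_system V), (eval (@point_var D V)).
  exists (exist _ F (ex_intro _ x rF)); split.
  + exact: point_system_poset.
  + exact: valuation_point.
  + exact: (eval_point valV _ _).1.
- by move=> [D [V [x [_ valV Vx]]]]; exists D, V, x.
- move=> [D [V [x [_ valV nVx]]]].
  exists (point_system V), (eval (@point_var D V)).
  (* Every point realizes the empty set, so a formula true there would hold at [x] as well. *)
  exists (exist _ set0 (ex_intro _ x (realizes_set0 V x))); split.
  + exact: point_system_poset.
  + exact: valuation_point.
  + by move=> /(eval_point valV _ _).2 /(_ _ (realizes_set0 V x)).
Qed.
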